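(* Let $C$ be the middle-third Cantor set, $\mu$ the natural Cantor probability measure on $C$, and $\gamma=\frac{\log 2}{\log 3}$. Let $\tau$ be a real number with $0<\tau<\frac{1-\gamma}{2}$. Then \[ \mu\left(\left\{x\in C:\ \|2^n x\|<n^{-\tau}\ \text{for infinitely many } n\in\mathbb N\right\}\right)=1 . \]
   Context: The middle-third Cantor set is $C=\{x\in[0,1]: x=\sum_{k=1}^\infty a_k 3^{-k},\ a_k\in\{0,2\}\}$. The natural Cantor probability measure $\mu$ is the law of $\sum_{k\ge1}a_k3^{-k}$ with $a_k$ independent and uniformly distributed on $\{0,2\}$. For $t\in\mathbb R$, $\|t\|=\min_{m\in\mathbb Z}|t-m|$ is the distance to the nearest integer. *)

(* Defs.v *)
From HB Require Import structures.
From mathcomp Require Import all_boot all_order all_algebra.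
From mathcomp Require Import finmap.
From mathcomp Require Import all_classical all_reals all_analysis.
From mathcomp Require Import measurable_realfun ring lra.

Set Implicit Arguments.
Unset Strict Implicit.
Unset Printing Implicit Defensive.

Import Order.TTheory GRing.Theory Num.Theory.
Import numFieldNormedType.Exports.

Local Open Scope classical_set_scope.
Local Open Scope ring_scope.

(* Digits are indexed from 0: [a k] is the digit of weight 3^-(k+1). *)
Definition ternary_sum (R : realType) (a : nat -> R) : nat -> R :=
  series (fun k => a k / 3 ^+ k.+1).

Definition cantor_set (R : realType) : set R :=
  [set x : R | 0 <= x <= 1 /\
    exists2 a : nat -> R, (forall k, a k = 0 \/ a k = 2) &
      ternary_sum a @ \oo --> x].

Definition mutually_independent d (T : measurableType d) (R : realType)
    (P : probability T R) (a : nat -> {RV P >-> R}) : Prop :=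
  forall (J : {fset nat}) (B : nat -> set R),
    (forall k, measurable (B k)) ->
    P (\bigcap_(k in [set` J]) (a k @^-1` B k)) =
    (\prod_(k <- J) P (a k @^-1` B k))%E.

Definition uniform_on_0_2 d (T : measurableType d) (R : realType)
    (P : probability T R) (X : {RV P >-> R}) : Prop :=
  P (X @^-1` [set 0]) = (2^-1)%:E /\ P (X @^-1` [set 2]) = (2^-1)%:E.

(* [mu] is the law of the random series [sum_k a_k 3^-(k+1)] (the limit [X],
   which exists almost surely), for i.i.d. digits uniform on {0, 2}.  The law
   does not depend on the probability space carrying the digits, and
   [cantor_measure_exists] below provides one. *)
Definition is_cantor_measure (R : realType)
    (mu : probability R R) : Prop :=
  exists (d : measure_display) (T : measurableType d) (P : probability T R)
         (a : nat -> {RV P >-> R}) (X : {RV P >-> R}),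
    [/\ mutually_independent a,
        forall k, uniform_on_0_2 (a k),
        {ae P, forall w, ternary_sum (fun k => a k w) @ \oo --> X w} &
        forall B : set R, measurable B -> mu B = distribution P X B].

Definition dist_int (R : realType) (t : R) : R :=
  inf [set `|t - m%:~R| | m in [set: int]].

(* Existence: the binary digits of a uniform point of [0, 1], doubled, are
   i.i.d. uniform on {0, 2}. *)
Section cantor_measure_existence.
Variable R : realType.

Let P : probability (measurableTypeR R) R :=
  uniform_prob (ltr01 : (0 : R) < 1).

Let dyadic (m j : nat) : set R := [set x : R | j%:R <= 2 ^+ m * x < j.+1%:R].

Let digit (k : nat) (x : measurableTypeR R) : R :=
  if odd (Num.truncn (2 ^+ k.+1 * x)) then 2 else 0.

Let digit02 k x : digit k x = 0 \/ digit k x = 2.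
Proof. by rewrite /digit; case: ifP; [right|left]. Qed.

Let measurable_digit k : measurable_fun setT (digit k).
Proof.
pose f (x : R) : R := (Num.truncn (2 ^+ k.+1 * x))%:R.
have mf : measurable_fun setT f.
  apply: nondecreasing_measurable => // x y xy.
  by rewrite /f ler_nat le_truncn// ler_wpM2l// exprn_ge0.
apply: measurable_fun_ifT => //.
apply: (measurable_fun_bool true); rewrite setTI.
rewrite (_ : _ @^-1` _ = \bigcup_(j in [set j | odd j]) (f @^-1` [set j%:R])).
  by apply: bigcup_measurable => j _; rewrite -[_ @^-1` _]setTI; exact: mf.
apply/seteqP; split=> [x /= ox|x [j /= oj] /eqP].
  by exists (Num.truncn (2 ^+ k.+1 * x)).
by rewrite /f eqr_nat => /eqP ->.
Qed.

Let dyadicE m j : dyadic m j = `[j%:R / 2 ^+ m, j.+1%:R / 2 ^+ m[%classic.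
Proof.
apply/seteqP; split=> x /=; rewrite in_itv/= ler_pdivrMr ?ltr_pdivlMr ?exprn_gt0//;
  by rewrite mulrC.
Qed.

Let measurable_dyadic m j : measurable (dyadic m j).
Proof. by rewrite dyadicE; exact: measurable_itv. Qed.

Let P_dyadic m j : (j < 2 ^ m)%N -> P (dyadic m j) = (2 ^- m)%:E.
Proof.
move=> jm; have m0 : (0 : R) < 2 ^+ m by rewrite exprn_gt0.
rewrite /P /= /uniform_prob.
rewrite (eq_integral (fun=> 1%:E)); last first.
  move=> x; rewrite inE dyadicE/= in_itv/= => /andP[xl xr].
  rewrite /uniform_pdf subr0 invr1 ifT//; apply/andP; split.
    by apply: le_trans xl; rewrite divr_ge0// ltW.
  apply/ltW/(lt_le_trans xr); rewrite ler_pdivrMr// mul1r.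
  by rewrite -natrX ler_nat.
rewrite integral_cst/= ?mul1e; last exact: measurable_dyadic.
rewrite dyadicE.
rewrite lebesgue_measure_itv/= lte_fin ltr_pM2r ?invr_gt0// ltr_nat ltnSn.
by rewrite -EFinD -mulrBl -natr1 addrAC subrr add0r mul1r.
Qed.

Let dyadic_split m j : dyadic m j = dyadic m.+1 j.*2 `|` dyadic m.+1 j.*2.+1.
Proof.
apply/seteqP; split=> x; rewrite /dyadic/= exprS -mulrA;
  rewrite -!muln2 -[j.+1%:R]natr1 -[(j * 2).+2%:R]natr1 -[(j * 2).+1%:R]natr1;
  rewrite !natrM; move: (2 ^+ m * x) (j%:R) => y z.
  move=> /andP[a b]; case: (ltP y (z + 2^-1)) => c; [left|right];
    apply/andP; split; lra.
by case=> /andP[a b]; apply/andP; split; lra.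
Qed.

Let dyadic_disj m j : dyadic m.+1 j.*2 `&` dyadic m.+1 j.*2.+1 = set0.
Proof.
rewrite -subset0 => x [] /andP[_ a] /andP[b _].
by have := lt_le_trans a b; rewrite ltxx.
Qed.

Let dyadic_digit m j x : dyadic m.+1 j x -> digit m x = if odd j then 2 else 0.
Proof. by move=> /truncn_def h; rewrite /digit h. Qed.

Let p (B : set R) : R := (0 \in B)%:R / 2 + (2 \in B)%:R / 2.

Let p_setT : p setT = 1.
Proof. by rewrite /p !in_setT -splitr. Qed.

Section cylinders.
Variable A : nat -> set R.
Hypothesis mA : forall k, measurable (A k).

Let cyl := fix cyl m n : set R :=
  if n is n'.+1 then digit m @^-1` A m `&` cyl m.+1 n' else setT.

Let measurable_cyl m n : measurable (cyl m n).
Proof.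
elim: n m => [|n ih] m /=; first exact: measurableT.
apply: measurableI; last exact: ih.
rewrite -[_ @^-1` _]setTI; apply: measurable_digit => //; exact: mA.
Qed.

Let measurable_dcyl m n i j : measurable (dyadic m i `&` cyl j n).
Proof.
by apply: measurableI; [exact: measurable_dyadic|exact: measurable_cyl].
Qed.

Let cylE m n : cyl m n = [set x | forall k, (m <= k < m + n)%N -> A k (digit k x)].
Proof.
elim: n m => [|n ih] m /=.
  apply/seteqP; split=> x // _ k; rewrite addn0 => /andP[a b].
  by have := leq_ltn_trans a b; rewrite ltnn.
rewrite ih; apply/seteqP; split=> [x [/= xm h] k|x h].
  rewrite leq_eqVlt => /andP[/orP[/eqP <-//|mk] kn]; apply: h.
  by rewrite mk addSnnS.
split=> /=; first by apply: h; rewrite leqnn addnS ltnS leq_addr.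
by move=> k /andP[mk kn]; apply: h; rewrite (ltnW mk) -addSnnS.
Qed.

Let P_cyl n m j : (j < 2 ^ m)%N ->
  P (dyadic m j `&` cyl m n) = (2 ^- m * \prod_(m <= k < m + n) p (A k))%:E.
Proof.
elim: n m j => [|n ih] m j jm.
  by rewrite setIT P_dyadic// addn0 big_geq// mulr1.
have half (i : nat) : (i < 2 ^ m.+1)%N ->
    P (dyadic m.+1 i `&` cyl m n.+1) =
    (((if odd i then 2 else 0) \in A m)%:R / 2 *
      (2 ^- m * \prod_(m.+1 <= k < m.+1 + n) p (A k)))%:E.
  move=> im; rewrite /= setIA.
  have [h|h] := boolP ((if odd i then 2 else 0) \in A m).
    rewrite (_ : dyadic m.+1 i `&` _ = dyadic m.+1 i); last first.
      by apply/setIidPl => x /dyadic_digit /= ->; rewrite inE in h.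
    by rewrite ih// exprS invfM mul1r mulrA.
  rewrite (_ : dyadic m.+1 i `&` _ = set0).
    by rewrite set0I measure0 !mul0r.
  rewrite -subset0 => x [] /dyadic_digit /= ->.
  by rewrite notin_setE in h.
have j2 : (j.*2.+1 < 2 ^ m.+1)%N.
  by rewrite expnS mul2n ltn_Sdouble.
rewrite dyadic_split setIUl.
transitivity (P (dyadic m.+1 j.*2 `&` cyl m n.+1) +
              P (dyadic m.+1 j.*2.+1 `&` cyl m n.+1))%E.
  apply: measureU; [exact: measurable_dcyl|exact: measurable_dcyl|].
  by rewrite setIACA dyadic_disj set0I.
rewrite !half ?(ltnW j2)//= odd_double/= -EFinD -mulrDl.
rewrite addSnnS [in RHS]big_ltn ?addnS ?ltnS ?leq_addr//.
by congr EFin; rewrite mulrCA.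
Qed.

Let P_cyl0 n : P (cyl 0 n) = (\prod_(0 <= k < n) p (A k))%:E.
Proof.
have P0 : P (dyadic 0 0) = 1%E by rewrite P_dyadic// expr0 invr1.
have Pc0 : P (~` dyadic 0 0) = 0%E.
  transitivity (1 - P (dyadic 0 0))%E; last by rewrite P0 subee.
  by apply: probability_setC; exact: measurable_dyadic.
have := @P_cyl n 0 0 isT; rewrite expr0 invr1 mul1r add0n => <-.
have mD : measurable (dyadic 0 0) := measurable_dyadic 0 0.
have mC : measurable (~` dyadic 0 0) by exact: measurableC.
have mc := measurable_cyl 0 n.
transitivity (P (dyadic 0 0 `&` cyl 0 n) + P (~` dyadic 0 0 `&` cyl 0 n))%E.
  rewrite -[in LHS](setTI (cyl 0 n)) -(setUv (dyadic 0 0)) setIUl.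
  apply: measureU; [exact: measurableI|exact: measurableI|].
  by rewrite setIACA setICr set0I.
rewrite [X in (_ + X)%E](_ : _ = 0%E) ?adde0//.
apply: (@subset_measure0 _ _ _ P _ (~` dyadic 0 0)) => //.
exact: measurableI.
Qed.

Lemma uniform_digit_cylinder n : P (\bigcap_(k in `I_n) (digit k @^-1` A k)) =
  (\prod_(0 <= k < n) p (A k))%:E.
Proof.
rewrite -P_cyl0 cylE.
by congr (P _).
Qed.

End cylinders.

Let digit_rv k : {RV P >-> R} :=
  HB.pack (digit k) (isMeasurableFun.Build _ _ _ _ (digit k) (measurable_digit k)).

Let P_digit_fset (J : {fset nat}) (B : nat -> set R) :
  (forall k, measurable (B k)) ->
  P (\bigcap_(k in [set` J]) (digit k @^-1` B k)) =
  (\prod_(k <- J) p (B k))%:E.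
Proof.
move=> mB; pose A k := if k \in J then B k else setT.
have mA k : measurable (A k) by rewrite /A; case: ifP.
pose n := (\max_(k <- J) k).+1.
have Jn k : k \in J -> (k < n)%N by move=> kJ; rewrite ltnS; exact: leq_bigmax_seq.
rewrite (_ : \bigcap_(k in _) _ = \bigcap_(k in `I_n) (digit k @^-1` A k)).
  rewrite uniform_digit_cylinder//; congr EFin.
  rewrite (bigID (mem J))/= [X in _ * X]big1 ?mulr1; last first.
    by move=> k kJ; rewrite /A (negbTE kJ) p_setT.
  rewrite -big_filter (perm_big (enum_fset J)); last first.
    apply: uniq_perm => [||k].
    - by rewrite filter_uniq// iota_uniq.
    - exact: fset_uniq.
    - rewrite mem_filter mem_index_iota/=.
      by apply/andP/idP => [[]//|kJ]; split => //; exact: Jn.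
  by rewrite [LHS]big_seq [RHS]big_seq; apply: eq_bigr => k kJ; rewrite /A kJ.
apply/seteqP; split=> x h k /= kn.
  by rewrite /A; case: ifP => // kJ; apply: h.
by have := h k (Jn _ kn); rewrite /A kn.
Qed.

Let P_digit1 k (B : set R) : measurable B -> P (digit k @^-1` B) = (p B)%:E.
Proof.
move=> mB; have := @P_digit_fset [fset k]%fset (fun=> B) (fun=> mB).
rewrite big_seq_fset1 => <-; congr (P _).
by rewrite set_fset1 bigcap_set1.
Qed.

Let cvg_digit (x : R) : cvgn (ternary_sum (fun k => digit k x)).
Proof.
apply: (@series_le_cvg _ _ (geometric 1 (3^-1))) => [k|k|k|].
- by rewrite divr_ge0 ?exprn_ge0//; case: (digit02 k x) => ->.
- by rewrite /= mul1r exprn_ge0// invr_ge0.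
- rewrite /= mul1r exprS invfM mulrA exprVn ler_piMl ?invr_ge0 ?exprn_ge0//.
  by case: (digit02 k x) => ->; lra.
- by apply: is_cvg_geometric_series; rewrite ger0_norm; lra.
Qed.

Let X (x : measurableTypeR R) : R :=
  limn (ternary_sum (fun k => digit k x)).

Let measurable_X : measurable_fun setT X.
Proof.
apply: (@measurable_fun_cvg _ _ _ _
  (fun n x => ternary_sum (fun k => digit k x) n)) => [n|x _]; last exact: cvg_digit.
by apply: measurable_sum => k; apply: measurable_funM.
Qed.

Let X_rv : {RV P >-> R} :=
  HB.pack X (isMeasurableFun.Build _ _ _ _ X measurable_X).

Lemma cantor_measure_exists :
  exists mu : probability R R, is_cantor_measure mu.
Proof.
exists (distribution P X_rv), _, (measurableTypeR R), P, digit_rv, X_rv.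
split=> //.
- move=> J B mB; rewrite [LHS]P_digit_fset// -prodEFin.
  by apply: eq_bigr => k _; rewrite /= P_digit1.
- have pE (z : R) : z = 0 \/ z = 2 -> p [set z] = 2^-1.
    have mE (x y : R) : (x \in [set y]) = (x == y) by apply/idP/eqP; rewrite inE.
    case=> ->; rewrite /p !mE eqxx.
      by rewrite pnatr_eq0 mul0r addr0 mul1r.
    by rewrite eq_sym pnatr_eq0 mul0r add0r mul1r.
  by move=> k; split; rewrite [LHS]P_digit1// pE//; [left|right].
- by apply: aeW => x; exact: cvg_digit.
Qed.

End cantor_measure_existence.

(* Main.v *)
Require Import Defs.
From mathcomp Require Import all_boot all_order all_algebra.
From mathcomp Require Import all_classical all_reals all_analysis.
From mathcomp Require Import finmap measurable_realfun zify ring lra.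

Import Order.TTheory GRing.Theory Num.Theory.
Import numFieldNormedType.Exports.

Local Open Scope classical_set_scope.
Local Open Scope ring_scope.

(* The argument is a second-moment estimate over the 2^L points [pt w] of the
   L-th stage of the construction of C, each of which carries probability 2^-L.
   Up to a phase, the Fourier transform of the uniform measure on these points
   at the integer frequency z is the product of cos (2 pi z / 3^i), i <= L.
   Since 2 generates the units modulo 3^(k+1), the frequencies u 2^m with
   m < N = 2 * 3^k and 3 not dividing u run over residue classes, and
   |cos x| + |cos (x + 2 pi / 3)| + |cos (x + 4 pi / 3)| <= 2 shows that the
   sum of the absolute values of the transform over m < N is at most 2^(k+1),
   which is of order N^gamma.  Hence the exponential sums
   sum_(n < N) e (a 2^(M + n) x), a <> 0, have mean square at most of order
   N^(1 + gamma), uniformly in a.  A trigonometric polynomial which is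
   nonpositive at distance more than c / K from the integers then bounds by
   O (K N^((gamma - 1) / 2)) the probability that 2^(M + n) x is at distance at
   least c / K from the integers for every n < N.  With K of order N^tau this
   tends to 0 because tau < (1 - gamma) / 2. *)

(** * The Fourier transform of the finite stages *)

Fixpoint words (L : nat) : seq (seq bool) :=
  if L is L'.+1
  then [seq rcons w b | w <- words L', b <- [:: false; true]] else [:: [::]].

Definition digit02 (R : realType) (b : bool) : R := if b then 2 else 0.

Definition pt (R : realType) (w : seq bool) : R :=
  \sum_(i < size w) digit02 R (nth false w i) / 3 ^+ i.+1.
Arguments pt {R}.

(** The modulus at [t] of the Fourier transform of the uniform measure on the points of stage [k]:
    digit [i] contributes the factor (1 + e^(2 i t / 3^(i+1))) / 2 (with imaginary unit in the
    exponent), of modulus |cos (t / 3^(i+1))|. *)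
Definition cos_prod (R : realType) (k : nat) (t : R) : R :=
  \prod_(i < k) `|cos (t / 3 ^+ i.+1)|.
Arguments cos_prod {R}.

Lemma wordsS L :
  words L.+1 = [seq rcons w b | w <- words L, b <- [:: false; true]].
Proof. by []. Qed.

Lemma size_words L w : w \in words L -> size w = L.
Proof.
elim: L w => [|L ih] w; first by rewrite inE => /eqP ->.
by rewrite wordsS; case/allpairsP => -[v b] /= [/ih <- _ ->]; rewrite size_rcons.
Qed.

Section cos_sums.
Variable R : realType.
Implicit Types (t u x y th ph : R) (k L : nat).

Lemma pt_rcons w b :
  pt (rcons w b) = pt w + digit02 R b / 3 ^+ (size w).+1 :> R.
Proof.
rewrite /pt size_rcons big_ord_recr /= nth_rcons ltnn eqxx; congr (_ + _).
by apply: eq_bigr => i _; rewrite nth_rcons ltn_ord.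
Qed.

Lemma sum_wordsS L (F : seq bool -> R) : \sum_(w <- words L.+1) F w =
  \sum_(w <- words L) (F (rcons w false) + F (rcons w true)).
Proof.
by rewrite wordsS big_allpairs_dep; apply: eq_bigr => w _; rewrite big_cons big_seq1.
Qed.

Lemma cosDcos x y : cos x + cos y = 2 * cos ((x + y) / 2) * cos ((x - y) / 2).
Proof.
set u := (x + y) / 2; set v := (x - y) / 2.
have -> : x = u + v by rewrite /u /v; field.
have -> : y = u - v by rewrite /u /v; field.
by rewrite cosD cosB; ring.
Qed.

(** The two extensions of a word differ by 2 / 3^(L+1), so sum-to-product yields the new cosine
    factor and moves the phase by [t / 3 ^+ L.+1]. The phase [th] is kept general to absorb this
    shift in the induction. *)
Lemma sum_words_cos L t th : exists ph, \sum_(w <- words L) cos (th + t * pt w) =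
  2 ^+ L * cos ph * \prod_(i < L) cos (t / 3 ^+ i.+1).
Proof.
elim: L th => [|L ih] th.
  by exists th; rewrite big_seq1 big_ord0 /pt big_ord0 mulr0 addr0 expr0 mulr1 mul1r.
rewrite sum_wordsS.
have -> : \sum_(w <- words L)
      (cos (th + t * pt (rcons w false)) + cos (th + t * pt (rcons w true))) =
    2 * cos (t / 3 ^+ L.+1) *
      \sum_(w <- words L) cos ((th + t / 3 ^+ L.+1) + t * pt w).
  rewrite mulr_sumr big_seq [RHS]big_seq; apply: eq_bigr => w /size_words wL.
  rewrite !pt_rcons wL /= mul0r addr0 cosDcos.
  rewrite -[LHS]mulrA [X in 2 * X]mulrC -[RHS]mulrA; congr (2 * (_ * _)).
    by rewrite -cosN; congr cos; field; rewrite expf_neq0.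
  by congr cos; field; rewrite expf_neq0.
have [ph ->] := ih (th + t / 3 ^+ L.+1); exists ph.
by rewrite big_ord_recr /= [2 ^+ L.+1]exprS; ring.
Qed.

Lemma norm_sum_words_cos L t :
  `|\sum_(w <- words L) cos (t * pt w)| <= 2 ^+ L * cos_prod L t.
Proof.
have [ph] := sum_words_cos L t 0.
under eq_bigr do rewrite add0r.
move=> ->; rewrite !normrM normr_prod ger0_norm ?exprn_ge0//.
rewrite -mulrA ler_wpM2l ?exprn_ge0// ler_piMl ?cos_max//.
exact: prodr_ge0.
Qed.

Lemma cosD2pin x (n : nat) : cos (x + 2 * pi * n%:R) = cos x.
Proof.
have -> : x + 2 * pi * n%:R = x + pi *+ 2 *+ n.
  by rewrite -[pi *+ 2 *+ n]mulr_natr -[pi *+ 2]mulr_natr; ring.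
exact: (periodicn (@cosD2pi R)).
Qed.

Lemma cos_prod_ge0 k t : 0 <= cos_prod k t.
Proof. exact: prodr_ge0. Qed.

Lemma cos_prod_le1 k t : cos_prod k t <= 1.
Proof. by apply: prodr_ile1 => i _; rewrite normr_ge0 cos_max. Qed.

Lemma cos_prodS k t : cos_prod k.+1 t = cos_prod k t * `|cos (t / 3 ^+ k.+1)|.
Proof. by rewrite /cos_prod big_ord_recr. Qed.

Lemma cos_prod_leq k L t : (k <= L)%N -> cos_prod L t <= cos_prod k t.
Proof.
move=> /subnKC <-; elim: (L - k)%N => [|m ih]; first by rewrite addn0.
by rewrite addnS cos_prodS (le_trans _ ih)// ler_piMr ?cos_prod_ge0 ?cos_max.
Qed.

(** Dropping the first [v] factors, each at most 1, leaves exactly [cos_prod k t]. This removes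
    powers of 3 from a frequency. *)
Lemma cos_prod_scale3 v k t : cos_prod (v + k) (3 ^+ v * t) <= cos_prod k t.
Proof.
elim: v t => [|v ih] t; first by rewrite add0n expr0 mul1r.
apply: le_trans (ih t); rewrite addSn /cos_prod big_ord_recl.
rewrite [X in _ * X](_ : _ = \prod_(i < v + k) `|cos (3 ^+ v * t / 3 ^+ i.+1)|).
  by rewrite ler_piMl ?cos_max ?prodr_ge0.
apply: eq_bigr => i _; congr `|cos _|; rewrite /bump /= ?add1n.
by rewrite [3 ^+ i.+2]exprS [3 ^+ v.+1]exprS; field; rewrite expf_neq0.
Qed.

(** With x = cos ph and z = sin ph sin (2 pi / 3), the last two terms add up to max (|x|, 2 |z|).
    Both 2 |x| and |x| + 2 |z| = |x| + sqrt 3 |sin ph| are at most 2, the latter by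
    Cauchy-Schwarz. *)
Lemma norm_cos_thirds ph :
  `|cos ph| + `|cos (ph + 2 * pi / 3)| + `|cos (ph + 4 * pi / 3)| <= 2.
Proof.
set a := 2 * pi / 3 : R.
have c0 : cos (a + a + a) = 1.
  have -> : a + a + a = 0 + 2 * pi * 1%:R by rewrite /a; field.
  by rewrite cosD2pin cos0.
have s0 : 0 < sin a.
  by rewrite sin_gt0_pi// /a; have := @pi_gt0 R; move=> ?; apply/andP; split; lra.
have cs := cos2Dsin2 a.
(* The triple angle formula turns cos (3 a) = 1 into (c - 1) (2 c + 1)^2 = 0 for c = cos a, and sin
   a > 0 excludes c = 1. *)
have ca : cos a = - 2^-1.
  rewrite !(cosD, sinD) in c0.
  have sE : sin a * sin a = 1 - cos a ^+ 2 by rewrite -cs; ring.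
  have : (cos a - 1) * (2 * cos a + 1) ^+ 2 = 0.
    have -> : (cos a - 1) * (2 * cos a + 1) ^+ 2 =
        4 * cos a ^+ 3 - 3 * cos a - 1 by ring.
    rewrite -[X in _ - X]c0.
    have -> : forall c s : R, 4 * c ^+ 3 - 3 * c - ((c * c - s * s) * c - (s * c + c * s) * s)
      = 3 * c * (c ^+ 2 + s * s - 1) by move=> *; ring.
    by rewrite sE; ring.
  move/eqP; rewrite mulf_eq0 expf_eq0/= => /orP[/eqP c1|/eqP c1]; last by lra.
  have : cos a = 1 by lra.
  move=> h; rewrite h expr1n in cs.
  have : 0 < sin a ^+ 2 by rewrite exprn_gt0.
  by lra.
have s3 : (2 * sin a) ^+ 2 = 3 by have := cs; rewrite ca; lra.
have -> : 4 * pi / 3 = a + a by rewrite /a; field.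
have -> : cos (ph + a) = - (cos ph / 2) - sin ph * sin a by rewrite cosD ca; field.
have -> : cos (ph + (a + a)) = - (cos ph / 2) + sin ph * sin a.
  rewrite cosD cosD sinD ca.
  have -> : sin a * sin a = 3 / 4 by lra.
  by field.
have := cos2Dsin2 ph; move: (cos ph) (sin ph) (sin a) s0 s3 => x y s s0 s3 xy.
have x1 : `|x| <= 1 by rewrite ler_norml; apply/andP; split; nra.
have xyl : `|x| + `|2 * (y * s)| <= 2.
  have h : (`|x| + `|2 * (y * s)|) ^+ 2 <= 2 ^+ 2.
    have h1 : `|x| ^+ 2 = x ^+ 2 by rewrite real_normK ?num_real.
    have h2 : `|2 * (y * s)| ^+ 2 = 3 * y ^+ 2.
      by rewrite real_normK ?num_real// -s3; ring.
    (* One third of this square is the defect in Cauchy-Schwarz. *)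
    have := sqr_ge0 (3 * `|x| - `|2 * (y * s)|); nra.
  by rewrite -ler_sqr ?nnegrE ?addr_ge0.
move: xyl; rewrite normrM (ger0_norm (ler0n _ _)); move: (y * s) x1 => z.
case: (ger0P z) => ?; case: (ger0P x) => ?;
  case: (ger0P (- (x / 2) - z)) => ?; case: (ger0P (- (x / 2) + z)) => ? ? ?; lra.
Qed.

End cos_sums.

(** * Frequencies along a geometric progression of ratio 2 *)

(** Lifting the exponent: 3^(k+1) divides 4^(3^k) - 1 exactly. The inductive step cubes 1 + 3^(k+1)
    q, and every term of the new cofactor except [q] is a multiple of 3. *)
Lemma pow4_pow3 k :
  exists2 q, (2 ^ (2 * 3 ^ k) = 1 + 3 ^ k.+1 * q)%N & ~~ (3 %| q)%N.
Proof.
elim: k => [|k [q qE q3]]; first by exists 1%N.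
exists (q + 3 ^ k.+1 * q ^ 2 + 3 ^ k * 3 ^ k.+1 * q ^ 3)%N.
  rewrite [(3 ^ k.+1)%N in LHS]expnS mulnCA mulnC expnM qE !expnS.
  by move: (3 ^ k)%N => p; ring.
rewrite -addnA dvdn_addl// dvdn_add// dvdn_mulr//.
- by rewrite expnS dvdn_mulr.
- by rewrite dvdn_mull// expnS dvdn_mulr.
Qed.

Section block_sums.
Variable R : realType.
Implicit Types (ph : R) (k L u c : nat).

(** Modulo 2 pi the shifts depend only on [c] mod 3; residue 2 merely exchanges the two shifted
    terms. *)
Lemma norm_cos_thirds_nat c ph : ~~ (3 %| c)%N ->
  `|cos ph| + `|cos (ph + 2 * pi * (c%:R / 3))|
  + `|cos (ph + 2 * pi * ((2 * c)%:R / 3))| <= 2.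
Proof.
move=> c3; rewrite (divn_eq c 3).
have : (c %% 3)%N = 1%N \/ (c %% 3)%N = 2%N.
  by move: c3; rewrite /dvdn; have := ltn_pmod c (isT : (0 < 3)%N); lia.
have := norm_cos_thirds _ ph; move: (c %/ 3)%N => q h [] ->.
  have -> : cos (ph + 2 * pi * ((q * 3 + 1)%:R / 3)) = cos (ph + 2 * pi / 3).
    rewrite -[RHS](cosD2pin _ _ q); congr cos.
    by rewrite natrD natrM; field.
  have -> : cos (ph + 2 * pi * ((2 * (q * 3 + 1))%:R / 3)) = cos (ph + 4 * pi / 3).
    rewrite -[RHS](cosD2pin _ _ (2 * q)); congr cos.
    by rewrite !natrM natrD !natrM; field.
  exact: h.
have -> : cos (ph + 2 * pi * ((q * 3 + 2)%:R / 3)) = cos (ph + 4 * pi / 3).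
  rewrite -[RHS](cosD2pin _ _ q); congr cos.
  by rewrite natrD natrM; field.
have -> : cos (ph + 2 * pi * ((2 * (q * 3 + 2))%:R / 3)) = cos (ph + 2 * pi / 3).
  rewrite -[RHS](cosD2pin _ _ (2 * q + 1)); congr cos.
  by rewrite !(natrM, natrD); field.
by rewrite addrAC.
Qed.

Lemma cos_prod_period k (a b : nat) :
  cos_prod k (2 * pi * (a + 3 ^ k * b)%:R) = cos_prod k (2 * pi * a%:R) :> R.
Proof.
apply: eq_bigr => i _; congr `|_|.
rewrite -[RHS](cosD2pin _ _ (3 ^ (k - i.+1) * b)); congr cos.
rewrite -{1}(subnK (ltn_ord i)) natrD !natrM expnD !natrM !natrX.
by field; rewrite expf_neq0.
Qed.

Lemma big_ord_mul3 n (F : nat -> R) :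
  \sum_(m < n * 3) F m = \sum_(m < n) (F m + F (m + n)%N + F (m + n + n)%N).
Proof.
have -> : (n * 3 = n + n + n)%N by lia.
rewrite big_split_ord big_split_ord /= !big_split /=.
congr (_ + _ + _); apply: eq_bigr => i _; congr F; lia.
Qed.

(** Tripling the range of exponents only doubles the sum. With n = 2 * 3^k, the exponents m, m + n,
    m + 2n give frequencies congruent modulo 3^(k+1), so the first k + 1 factors agree; the last
    factors have phases differing by the three multiples of 2 pi / 3 and add up to at most 2. *)
Lemma sum_cos_prod_pow2 k u : ~~ (3 %| u)%N ->
  \sum_(m < 2 * 3 ^ k) cos_prod k.+1 (2 * pi * (u * 2 ^ m)%:R) <= 2 ^+ k.+1 :> R.
Proof.
move=> u3; elim: k => [|k ih].
  apply: (@le_trans _ _ (\sum_(m < 2 * 3 ^ 0) (1 : R))).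
    by apply: ler_sum => m _; exact: cos_prod_le1.
  by rewrite sumr_const card_ord muln1.
have [q qE q3] := pow4_pow3 k; set n := (2 * 3 ^ k)%N in ih qE *.
have -> : (2 * 3 ^ k.+1 = n * 3)%N by rewrite /n expnS; lia.
pose G m : R := cos_prod k.+2 (2 * pi * (u * 2 ^ m)%:R).
rewrite (big_ord_mul3 n G) exprS; apply: le_trans (ler_wpM2l (ler0n _ 2) ih).
rewrite mulr_sumr; apply: ler_sum => m _.
rewrite /G ![cos_prod k.+2 _]cos_prodS.
set y := (u * 2 ^ m)%N.
have y3 : ~~ (3 %| y * q)%N.
  rewrite !Euclid_dvdM// !negb_or u3 q3 andbT/=.
  by rewrite Euclid_dvdX// negb_and.
have E1 : (u * 2 ^ (m + n) = y + 3 ^ k.+1 * (y * q))%N.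
  by rewrite expnD qE /y; ring.
(* The same frequency is written twice: [E2] isolates a multiple of 3^(k+2), invisible to the last
   factor, and [E3] a multiple of 3^(k+1), invisible to the others. *)
have E2 : (u * 2 ^ (m + n + n) = y + 3 ^ k.+1 * (2 * (y * q))
    + 3 ^ k.+2 * (3 ^ k * (y * q * q)))%N.
  by rewrite 2!expnD qE /y !expnS; move: (3 ^ k)%N => z; ring.
have E3 : (u * 2 ^ (m + n + n) = y + 3 ^ k.+1 * (2 * (y * q) + 3 ^ k.+1 * (y * q * q)))%N.
  by rewrite E2 !expnS; move: (3 ^ k)%N => z; ring.
rewrite {1}E1 {1}E3 !cos_prod_period -!mulrDr mulrC ler_wpM2r ?cos_prod_ge0//.
pose ph : R := 2 * pi * y%:R / 3 ^+ k.+2.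
have e1 : cos (2 * pi * (u * 2 ^ (m + n))%:R / 3 ^+ k.+2) =
    cos (ph + 2 * pi * ((y * q)%:R / 3)).
  rewrite E1; congr cos; rewrite /ph natrD natrM natrX !exprS.
  by field; rewrite expf_neq0.
have e2 : cos (2 * pi * (u * 2 ^ (m + n + n))%:R / 3 ^+ k.+2) =
    cos (ph + 2 * pi * ((2 * (y * q))%:R / 3)).
  rewrite E2 -[RHS](cosD2pin _ _ (3 ^ k * (y * q * q))); congr cos.
  rewrite /ph !natrD [(3 ^ k.+1 * _)%:R]natrM [(3 ^ k.+2 * _)%:R]natrM !natrX !exprS.
  by field; rewrite expf_neq0.
by rewrite e1 e2; exact: norm_cos_thirds_nat.
Qed.

End block_sums.

(** * Moments of exponential sums *)

Section moments.
Variable R : realType.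
Implicit Types (k L M N a c d : nat).

(** Write c = 3^v u with [u] prime to 3. The crude bound v <= c ensures that k + 1 of the [L]
    factors remain once the power of 3 is removed. *)
Lemma sum_cos_prod_dyadic k L c : (0 < c)%N -> (k.+1 + c <= L)%N ->
  \sum_(n < 2 * 3 ^ k) cos_prod L (2 * pi * (c * 2 ^ n)%:R) <= 2 ^+ k.+1 :> R.
Proof.
move=> c0 kL; pose v := logn 3 c; pose u := (c %/ 3 ^ v)%N.
have cE : (c = 3 ^ v * u)%N by rewrite mulnC divnK// pfactor_dvdnn.
have u3 : ~~ (3 %| u)%N.
  apply/negP => /dvdnP[u' uE].
  have : (3 ^ v.+1 %| c)%N by rewrite cE uE expnSr mulnCA dvdn_mull.
  by rewrite pfactor_dvdn// ltnn.
have vc : (v <= c)%N by apply: ltnW (leq_trans (ltn_expl v (isT : 1 < 3)%N) _); rewrite dvdn_leq// pfactor_dvdnn.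
apply: le_trans (sum_cos_prod_pow2 R k u u3); apply: ler_sum => n _.
have vL : (v + k.+1 <= L)%N by rewrite addnC (leq_trans _ kL)// leq_add2l.
apply: le_trans (cos_prod_leq _ _ _ _ vL) _.
rewrite (_ : 2 * pi * (c * 2 ^ n)%:R = 3 ^+ v * (2 * pi * (u * 2 ^ n)%:R)).
  exact: cos_prod_scale3.
by rewrite {1}cE !natrM natrX; ring.
Qed.

(** Pairs are indexed by their minimum and their gap. Each half n <= m or m <= n is at most the full
    sum, since letting both indices run up to [N] only adds nonnegative terms. *)
Lemma sum_pairs_le N (h : nat -> nat -> R) : (forall i d, 0 <= h i d) ->
  \sum_(n < N) \sum_(m < N) h (minn n m) (maxn n m - minn n m)%N <=
  2 * \sum_(d < N) \sum_(n < N) h n d.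
Proof.
move=> h0.
pose T := \sum_(n < N) \sum_(m < N | (n <= m)%N) h n (m - n)%N.
have TS : T <= \sum_(d < N) \sum_(n < N) h n d.
  rewrite exchange_big; apply: ler_sum => n _.
  have -> : \sum_(m < N | (n <= m)%N) h n (m - n)%N =
      \sum_(n <= m < N) h n (m - n)%N by rewrite big_geq_mkord.
  rewrite -(big_mkord xpredT (h n)).
  rewrite -{1}[n : nat]add0n big_addn.
  under eq_bigr do rewrite addnK.
  rewrite [leRHS](@big_cat_nat _ _ _ (N - n))//= ?leq_subr//.
  by rewrite lerDl sumr_ge0.
rewrite mulr_natl mulr2n; apply: le_trans (lerD TS TS).
have TE : T = \sum_(n < N) \sum_(m < N | (m <= n)%N) h m (n - m)%N.
  by rewrite /T (exchange_big_dep predT).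
rewrite [X in _ + X]TE /T -big_split/=.
apply: ler_sum => n _; rewrite [X in _ <= X + _]big_mkcond [X in _ <= _ + X]big_mkcond -big_split/=.
apply: ler_sum => m _; case: (ltngtP n m) => [nm|mn|->].
- by rewrite addr0.
- by rewrite add0r.
- by rewrite subnn lerDl.
Qed.

Lemma sqr_sum_cos_sin (I : finType) (x s : I -> R) :
  (\sum_i s i * cos (x i)) ^+ 2 + (\sum_i s i * sin (x i)) ^+ 2 =
  \sum_i \sum_j s i * s j * cos (x i - x j).
Proof.
rewrite !expr2 !mulr_suml -big_split; apply: eq_bigr => i _ /=.
rewrite !mulr_sumr -big_split; apply: eq_bigr => j _ /=.
by rewrite cosB; ring.
Qed.

Definition dyadic_angle M (w : seq bool) (n : nat) : R :=
  2 * pi * 2 ^+ (M + n) * pt w.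

Lemma sum_words_const L (x : R) : \sum_(w <- words L) x = 2 ^+ L * x.
Proof.
elim: L x => [|L ih] x; first by rewrite big_seq1 expr0 mul1r.
by rewrite sum_wordsS ih exprS; ring.
Qed.

(** Expanding the square gives pairs whose difference frequency is a 2^M (2^d - 1) 2^n. For a fixed
    gap d > 0 these run along a progression of ratio 2 and contribute at most 2^(k+1); the gap 0
    contributes N. The condition on [L] covers the largest gap. *)
Lemma second_moment k L M a (N := (2 * 3 ^ k)%N) :
  (0 < a)%N -> (k.+1 + a * 2 ^ (M + N) <= L)%N ->
  \sum_(w <- words L) (\sum_(n < N) cos (a%:R * dyadic_angle M w n)) ^+ 2 <=
  2 ^+ L * (4 * N%:R * 2 ^+ k.+1).
Proof.
move=> a0 kL.
pose f (n d : nat) := (a * 2 ^ M * (2 ^ d - 1) * 2 ^ n)%N.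
pose h (n d : nat) : R := cos_prod L (2 * pi * (f n d)%:R).
have h0 n d : 0 <= h n d by exact: cos_prod_ge0.
have angleE w (n d : nat) :
    a%:R * dyadic_angle M w (n + d) - a%:R * dyadic_angle M w n =
    2 * pi * (f n d)%:R * pt w.
  rewrite /dyadic_angle /f !natrM natrB ?expn_gt0// !natrX !exprD; ring.
have pairE w (n m : nat) :
    cos (a%:R * dyadic_angle M w n - a%:R * dyadic_angle M w m) =
    cos (2 * pi * (f (minn n m) (maxn n m - minn n m)%N)%:R * pt w).
  case: (leqP n m) => [nm|/ltnW mn].
    by rewrite -cosN opprB -{1}(subnKC nm) angleE.
  by rewrite -{1}(subnKC mn) angleE.
apply: (@le_trans _ _ (\sum_(n < N) \sum_(m < N)
    2 ^+ L * h (minn n m) (maxn n m - minn n m)%N)).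
  apply: (@le_trans _ _ (\sum_(w <- words L) \sum_(n < N) \sum_(m < N)
      cos (2 * pi * (f (minn n m) (maxn n m - minn n m)%N)%:R * pt w))).
    apply: ler_sum => w _.
    have := sqr_sum_cos_sin _ (fun n : 'I_N => a%:R * dyadic_angle M w n) (fun=> 1).
    under eq_bigr do rewrite mul1r.
    under [X in _ = X -> _]eq_bigr do
      under eq_bigr do rewrite mul1r mul1r pairE.
    by move=> <-; rewrite lerDl sqr_ge0.
  rewrite exchange_big; apply: ler_sum => n _.
  rewrite exchange_big; apply: ler_sum => m _.
  by apply: le_trans (ler_norm _) _; exact: norm_sum_words_cos.
under eq_bigr do rewrite -mulr_sumr.
rewrite -mulr_sumr ler_wpM2l ?exprn_ge0//.
apply: le_trans (sum_pairs_le _ _ h0) _.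
have N0 : (0 < N)%N by rewrite muln_gt0 expn_gt0.
have hd (d : 'I_N) : \sum_(n < N) h n d <= (if d == 0 :> nat then N%:R else 2 ^+ k.+1).
  case: eqP => [d0|/eqP d0].
    apply: (@le_trans _ _ (\sum_(n < N) (1 : R))).
      by apply: ler_sum => n _; exact: cos_prod_le1.
    by rewrite sumr_const card_ord.
  have d1 : (0 < 2 ^ d - 1)%N by rewrite subn_gt0 -{1}(expn0 2) ltn_exp2l// lt0n.
  apply: sum_cos_prod_dyadic; first by rewrite !muln_gt0 a0 expn_gt0.
  apply: leq_trans kL; rewrite leq_add2l -mulnA leq_mul2l.
  by rewrite expnD leq_mul2l (leq_trans (leq_subr _ _)) ?orbT// leq_exp2l// ltnW.
apply: (@le_trans _ _ (2 * (\sum_(d < N) (2 ^+ k.+1 + (if d == 0 :> nat then N%:R else 0))))).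
  rewrite ler_wpM2l//; apply: ler_sum => d _; apply: le_trans (hd d) _.
  by case: ifP => _; rewrite ?addr0// lerDr exprn_ge0.
rewrite big_split/= sumr_const card_ord -(prednK N0) big_ord_recl/= prednK//.
rewrite big1// addr0 -[2 ^+ k.+1 *+ N]mulr_natr.
have : (1 : R) <= 2 ^+ k.+1 by rewrite exprn_ege1// ler1n.
have : 0 <= N%:R :> R by [].
by move: (2 ^+ k.+1) (N%:R) => x y y0 x1; nra.
Qed.

(** The passage from the second moment uses |x| <= x^2 / (2 sg) + sg / 2 in place of Cauchy-Schwarz;
    [sg] bounds the root mean square. *)
Lemma first_moment k L M a (sg : R) (N := (2 * 3 ^ k)%N) :
  (0 < a)%N -> (k.+1 + a * 2 ^ (M + N) <= L)%N ->
  0 < sg -> 4 * N%:R * 2 ^+ k.+1 <= sg ^+ 2 ->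
  \sum_(w <- words L) `|\sum_(n < N) cos (a%:R * dyadic_angle M w n)| <=
  2 ^+ L * sg.
Proof.
move=> a0 kL sg0 sg2.
have amgm (x : R) : `|x| <= x ^+ 2 * (2 * sg)^-1 + sg / 2.
  have -> : x ^+ 2 * (2 * sg)^-1 + sg / 2 = (`|x| ^+ 2 + sg ^+ 2) / (2 * sg).
    by rewrite real_normK ?num_real//; field; rewrite gt_eqF.
  rewrite ler_pdivlMr ?mulr_gt0//.
  by have := sqr_ge0 (`|x| - sg); nra.
apply: le_trans (ler_sum _ (fun w _ => amgm _)) _.
rewrite big_split/= -mulr_suml sum_words_const.
have -> : 2 ^+ L * sg = 2 ^+ L * sg ^+ 2 * (2 * sg)^-1 + 2 ^+ L * (sg / 2).
  by field; rewrite gt_eqF.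
rewrite lerD2r ler_wpM2r ?invr_ge0 ?mulr_ge0 ?(ltW sg0)//.
by apply: le_trans (second_moment _ _ _ _ a0 kL) _; rewrite ler_wpM2l ?exprn_ge0.
Qed.

End moments.

(** * A trigonometric minorant *)

Section trig_poly.
Variable R : realType.
Implicit Types (s : nat -> R) (th : R) (m k L M K : nat).

(* |sum_(j < m) s j e^(i j th)|^2 *)
Definition trig_sqr s m th : R :=
  (\sum_(j < m) s j * cos (j%:R * th)) ^+ 2 +
  (\sum_(j < m) s j * sin (j%:R * th)) ^+ 2.

Lemma trig_sqr_ge0 s m th : 0 <= trig_sqr s m th.
Proof. by rewrite addr_ge0 ?sqr_ge0. Qed.

(** The diagonal of the expanded square is the subtracted constant term. Each off-diagonal pair (j,
    l) is an exponential sum of frequency |j - l|, between 1 and [m], to which the first moment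
    bound applies. *)
Lemma trig_sqr_moment s m k L M (sg : R) (N := (2 * 3 ^ k)%N) :
  (k.+1 + m * 2 ^ (M + N) <= L)%N ->
  0 < sg -> 4 * N%:R * 2 ^+ k.+1 <= sg ^+ 2 ->
  \sum_(w <- words L) `|\sum_(n < N) trig_sqr s m (dyadic_angle R M w n)
                        - N%:R * \sum_(j < m) s j ^+ 2| <=
  2 ^+ L * sg * (\sum_(j < m) `|s j|) ^+ 2.
Proof.
move=> kL sg0 sg2.
pose C w (j l : nat) : R :=
  \sum_(n < N) cos (j%:R * dyadic_angle R M w n - l%:R * dyadic_angle R M w n).
have dE w : \sum_(n < N) trig_sqr s m (dyadic_angle R M w n)
      - N%:R * \sum_(j < m) s j ^+ 2 =
    \sum_(j < m) \sum_(l < m) s j * s l * (if j == l then 0 else C w j l).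
  under eq_bigr do rewrite /trig_sqr sqr_sum_cos_sin.
  rewrite exchange_big mulr_sumr -sumrB; apply: eq_bigr => j _.
  rewrite exchange_big (bigD1 j)//= [RHS](bigD1 j)//= eqxx mulr0 add0r.
  have -> : \sum_(n < N) s j * s j *
      cos (j%:R * dyadic_angle R M w n - j%:R * dyadic_angle R M w n) =
      N%:R * s j ^+ 2.
    under eq_bigr do rewrite subrr cos0 mulr1.
    by rewrite sumr_const card_ord expr2 mulr_natl.
  rewrite addrAC subrr add0r; apply: eq_bigr => l lj.
  by rewrite eq_sym (negbTE lj) -mulr_sumr.
have CE (j l : 'I_m) : j != l ->
    \sum_(w <- words L) `|C w j l| <= 2 ^+ L * sg.
  move=> jl; pose a := (maxn j l - minn j l)%N.
  have a0 : (0 < a)%N.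
    by rewrite /a subn_gt0; move: jl; rewrite -val_eqE /=; lia.
  have am : (a <= m)%N.
    by have := ltn_ord j; have := ltn_ord l; rewrite /a; lia.
  have aL : (k.+1 + a * 2 ^ (M + N) <= L)%N.
    by apply: leq_trans kL; rewrite leq_add2l leq_mul2r am orbT.
  apply: le_trans (first_moment R k L M a sg a0 aL sg0 sg2).
  apply: ler_sum => w _; rewrite le_eqVlt; apply/orP; left; apply/eqP.
  congr `|_|; apply: eq_bigr => n _; rewrite -mulrBl /a.
  case: (leqP j l) => [jl'|/ltnW lj]; last by rewrite natrB.
  by rewrite natrB// -cosN -mulNr opprB.
under eq_bigr do rewrite dE.
apply: (@le_trans _ _ (\sum_(w <- words L) \sum_(j < m) \sum_(l < m)
   `|s j| * `|s l| * (if j == l then 0 else `|C w j l|))).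
  apply: ler_sum => w _; apply: le_trans (ler_norm_sum _ _ _) _.
  apply: ler_sum => j _; apply: le_trans (ler_norm_sum _ _ _) _.
  by apply: ler_sum => l _; rewrite !normrM; case: eqP => // _; rewrite normr0.
rewrite exchange_big expr2 mulr_suml mulr_sumr; apply: ler_sum => j _.
rewrite exchange_big !mulr_sumr; apply: ler_sum => l _.
rewrite -mulr_sumr [leRHS]mulrC ler_wpM2l ?mulr_ge0//.
case: (eqVneq j l) => [_|/CE//].
by rewrite big1// mulr_ge0 ?exprn_ge0// ltW.
Qed.

Definition diff_seq s (j : nat) : R := s j - (if j is j'.+1 then s j' else 0).

(** Summation by parts, with the convention s (-1) = 0 built into [diff_seq]. *)
Lemma sum_diff_seq s m (c : nat -> R) :
  \sum_(j < m.+1) diff_seq s j * c j =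
  \sum_(j < m) s j * (c j - c j.+1) + s m * c m.
Proof.
elim: m => [|m ih].
  by rewrite big_ord_recr !big_ord0 /= /diff_seq subr0.
by rewrite big_ord_recr /= ih [in RHS]big_ord_recr /= /diff_seq; ring.
Qed.

(* Multiplying the polynomial by 1 - e^(i th) differences its coefficients. *)
Lemma trig_sqr_diff s m th : s m = 0 ->
  trig_sqr (diff_seq s) m.+1 th = 2 * (1 - cos th) * trig_sqr s m th.
Proof.
move=> sm; rewrite /trig_sqr.
rewrite (sum_diff_seq _ _ (fun j => cos (j%:R * th))).
rewrite (sum_diff_seq _ _ (fun j => sin (j%:R * th))) sm !mul0r !addr0.
set A := \sum_(j < m) s j * cos _; set B := \sum_(j < m) s j * sin _.
have -> : \sum_(j < m) s j * (cos (j%:R * th) - cos (j.+1%:R * th)) =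
    A - (A * cos th - B * sin th).
  rewrite /A /B !mulr_suml -!sumrB; apply: eq_bigr => j _.
  by rewrite -natr1 mulrDl mul1r cosD; ring.
have -> : \sum_(j < m) s j * (sin (j%:R * th) - sin (j.+1%:R * th)) =
    B - (B * cos th + A * sin th).
  rewrite /A /B !mulr_suml -big_split -!sumrB; apply: eq_bigr => j _.
  by rewrite -natr1 mulrDl mul1r sinD /=; ring.
have s2 : sin th ^+ 2 = 1 - cos th ^+ 2 by exact: sin2cos2.
have -> : forall a b c d : R, (a - (a * c - b * d)) ^+ 2 + (b - (b * c + a * d)) ^+ 2
   = ((1 - c) ^+ 2 + d ^+ 2) * (a ^+ 2 + b ^+ 2) by move=> *; ring.
by rewrite s2; ring.
Qed.

(** The values are 1, ..., K, K, ..., 1 and then 0 at j = 2K. The squares sum to order K^3 but those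
    of the differences only to order K, which gives the resolution 1 / K. *)
Definition tent K (j : nat) : R := (minn j.+1 (2 * K - j))%:R.

Lemma tent_end K : tent K (2 * K) = 0.
Proof. by rewrite /tent subnn minn0. Qed.

Lemma norm_diff_tent K j : (j <= 2 * K)%N -> `|diff_seq (tent K) j| <= 1.
Proof.
case: j => [|j] jK; rewrite /diff_seq /tent.
  by rewrite subr0 ger0_norm// ler_nat geq_minl.
rewrite ler_distlC; apply/andP; split.
  by rewrite lerBlDr natr1 ler_nat; lia.
by rewrite natr1 ler_nat; lia.
Qed.

Lemma sum_sqr_tent_ge K : 2 / 3 * K%:R ^+ 3 <= \sum_(j < 2 * K) tent K j ^+ 2.
Proof.
have h (n : nat) : n%:R ^+ 3 / 3 <= \sum_(j < n) (j.+1%:R : R) ^+ 2.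
  elim: n => [|n ih]; first by rewrite big_ord0 expr0n/= mul0r.
  rewrite big_ord_recr/=; apply: le_trans (lerD ih (lexx _)).
  by rewrite -natr1; have : 0 <= n%:R :> R by []; move: n%:R => x x0; nra.
have -> : (2 * K = K + K)%N by lia.
rewrite big_split_ord/=.
have e1 : \sum_(j < K) tent K (lshift K j) ^+ 2 = \sum_(j < K) (j.+1%:R : R) ^+ 2.
  apply: eq_bigr => j _; rewrite /tent /=; congr (_%:R ^+ 2).
  by have := ltn_ord j; lia.
have e2 : \sum_(j < K) tent K (rshift K j) ^+ 2 = \sum_(j < K) (j.+1%:R : R) ^+ 2.
  rewrite [RHS](reindex_inj rev_ord_inj)/=.
  apply: eq_bigr => j _; rewrite /tent /=; congr (_%:R ^+ 2).
  by have := ltn_ord j; lia.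
by rewrite e1 e2; have := h K; lra.
Qed.

Lemma sum_tent_le K : \sum_(j < 2 * K) `|tent K j| <= 2 * K%:R ^+ 2.
Proof.
apply: (@le_trans _ _ (\sum_(j < 2 * K) (K%:R : R))).
  by apply: ler_sum => j _; rewrite ger0_norm// ler_nat; have := ltn_ord j; lia.
by rewrite sumr_const card_ord -[leLHS]mulr_natl natrM expr2 mulrA.
Qed.

(** For S = [trig_sqr (tent K) (2 * K)] and E = [trig_sqr e (2 * K).+1], the polynomial 6 / K^2 S -
    E / 2 equals (6 / K^2 - (1 - cos)) S. On a bad word it is nonpositive at all [N] angles,
    although its constant term is at least 4K - 3K/2. The deviations [DS], [DE] from the constant
    terms must then be large, and their first moments limit the number of such words. *)
Lemma count_no_hit k L M K (sg : R) (N := (2 * 3 ^ k)%N) :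
  (0 < K)%N -> (k.+1 + (2 * K).+1 * 2 ^ (M + N) <= L)%N ->
  0 < sg -> 4 * N%:R * 2 ^+ k.+1 <= sg ^+ 2 ->
  \sum_(w <- words L)
    [forall n : 'I_N, 6 / K%:R ^+ 2 <= 1 - cos (dyadic_angle R M w n)]%:R * N%:R
    <= 2 ^+ L * (15 * K%:R * sg) :> R.
Proof.
move=> K0 kL sg0 sg2; pose bad w := [forall n : 'I_N,
  6 / K%:R ^+ 2 <= 1 - cos (dyadic_angle R M w n)].
rewrite -/N; under eq_bigr do rewrite -/(bad _).
have K1 : 1 <= K%:R :> R by rewrite ler1n.
set e := diff_seq (tent K).
pose ES := \sum_(j < 2 * K) tent K j ^+ 2.
pose EE := \sum_(j < (2 * K).+1) e j ^+ 2.
pose DS w : R := \sum_(n < N) trig_sqr (tent K) (2 * K) (dyadic_angle R M w n)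
  - N%:R * ES.
pose DE w : R := \sum_(n < N) trig_sqr e (2 * K).+1 (dyadic_angle R M w n)
  - N%:R * EE.
have eta0 : 0 <= 6 / K%:R ^+ 2 :> R by rewrite divr_ge0 ?exprn_ge0.
have EEle : EE <= 3 * K%:R.
  apply: (@le_trans _ _ (\sum_(j < (2 * K).+1) (1 : R))).
    apply: ler_sum => j _; rewrite -real_normK ?num_real// expr_le1//.
    by apply: norm_diff_tent; rewrite -ltnS.
  by rewrite sumr_const card_ord -[leLHS]natr1 natrM; lra.
have Sele : \sum_(j < (2 * K).+1) `|e j| <= 3 * K%:R.
  apply: (@le_trans _ _ (\sum_(j < (2 * K).+1) (1 : R))).
    by apply: ler_sum => j _; apply: norm_diff_tent; rewrite -ltnS.
  by rewrite sumr_const card_ord -[leLHS]natr1 natrM; lra.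
(* The 6 is chosen here: 6 * 2/3 = 4 exceeds half the constant 3 in [EEle] by more than 2. *)
have ESge : 4 * K%:R <= 6 / K%:R ^+ 2 * ES.
  rewrite (_ : 4 * K%:R = 6 / K%:R ^+ 2 * (2 / 3 * K%:R ^+ 3)).
    by rewrite ler_wpM2l// sum_sqr_tent_ge.
  by field; lra.
have badle w : (bad w)%:R * N%:R * (2 * K%:R) <=
    6 / K%:R ^+ 2 * `|DS w| + 2^-1 * `|DE w|.
  case: (boolP (bad w)) => [/forallP b|_]; last first.
    by rewrite mul0r mul0r addr_ge0 ?mulr_ge0.
  rewrite mul1r.
  have key : 6 / K%:R ^+ 2 * (DS w + N%:R * ES) <= 2^-1 * (DE w + N%:R * EE).
    rewrite /DS /DE !subrK !mulr_sumr; apply: ler_sum => n _.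
    rewrite trig_sqr_diff ?tent_end// !mulrA mulVf ?mul1r//.
    by rewrite ler_wpM2r ?trig_sqr_ge0.
  have n1 : - `|DS w| <= DS w by rewrite lerNl -normrN ler_norm.
  have n2 := ler_norm (DE w).
  have n3 : 6 / K%:R ^+ 2 * - `|DS w| <= 6 / K%:R ^+ 2 * DS w by rewrite ler_wpM2l.
  have N0 : 0 <= N%:R :> R by [].
  have n4 : N%:R * (4 * K%:R) <= N%:R * (6 / K%:R ^+ 2 * ES) by rewrite ler_wpM2l.
  have n5 : N%:R * EE <= N%:R * (3 * K%:R) by rewrite ler_wpM2l.
  have n6 : 0 <= N%:R * K%:R :> R by rewrite mulr_ge0.
  move: key n1 n2 n3 n4 n5 n6; move: (DS w) (DE w) (ES : R) (EE : R) (6 / K%:R ^+ 2 : R) (N%:R : R) (K%:R : R).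
  by move=> ds de es ee eta x y *; lra.
have kL' : (k.+1 + (2 * K) * 2 ^ (M + N) <= L)%N.
  by apply: leq_trans kL; rewrite leq_add2l leq_mul2r leqnSn orbT.
have mS := trig_sqr_moment (tent K) _ _ _ _ _ kL' sg0 sg2.
have mE := trig_sqr_moment e _ _ _ _ _ kL sg0 sg2.
have P0 : 0 <= 2 ^+ L * sg by rewrite mulr_ge0 ?exprn_ge0 ?ltW.
have SS : (\sum_(j < 2 * K) `|tent K j|) ^+ 2 <= 4 * K%:R ^+ 4.
  rewrite (_ : 4 * K%:R ^+ 4 = (2 * K%:R ^+ 2) ^+ 2); last by ring.
  by rewrite ler_sqr ?nnegrE ?sumr_ge0 ?mulr_ge0 ?exprn_ge0// sum_tent_le.
have SE : (\sum_(j < (2 * K).+1) `|e j|) ^+ 2 <= 9 * K%:R ^+ 2.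
  rewrite (_ : 9 * K%:R ^+ 2 = (3 * K%:R) ^+ 2); last by ring.
  by rewrite ler_sqr ?nnegrE ?sumr_ge0 ?mulr_ge0.
have total : (\sum_(w <- words L) (bad w)%:R * N%:R) * (2 * K%:R) <=
    6 / K%:R ^+ 2 * (2 ^+ L * sg * (4 * K%:R ^+ 4)) +
    2^-1 * (2 ^+ L * sg * (9 * K%:R ^+ 2)).
  rewrite mulr_suml; apply: le_trans (ler_sum _ (fun w _ => badle w)) _.
  rewrite big_split/= -!mulr_sumr lerD// ler_wpM2l//.
    by apply: le_trans mS _; rewrite ler_wpM2l.
  by apply: le_trans mE _; rewrite ler_wpM2l.
rewrite -(@ler_pM2r _ (2 * K%:R)) ?mulr_gt0 ?ltr0n//; apply: le_trans total _.
(* Here 57/2 = 6 * 4 + 9/2, and 30 = 15 * 2 is the stated constant times the cancelled factor. *)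
rewrite [leLHS](_ : _ = 2 ^+ L * sg * K%:R ^+ 2 * (57 / 2)); last by field; lra.
rewrite [leRHS](_ : _ = 2 ^+ L * sg * K%:R ^+ 2 * 30); last by ring.
by rewrite ler_wpM2l ?mulr_ge0 ?exprn_ge0//; lra.
Qed.

End trig_poly.

(** * Distance to the integers and measurability *)

Lemma infinite_nat_setP (A : set nat) :
  infinite_set A <-> forall m, exists2 n, (m <= n)%N & A n.
Proof.
split=> [Ainf m|h].
  apply: contrapT => nA; apply: Ainf; apply: (sub_finite_set _ (finite_II m)).
  move=> n An /=; rewrite ltnNge; apply/negP => mn.
  by apply: nA; exists n.
move=> /finite_fsetP[X AX].
have [n Xn An] := h (\max_(i <- X) i).+1.
have nX : n \in X by move: An; rewrite AX.
have : (n <= \max_(i <- X) i)%N by exact: leq_bigmax_seq.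
by rewrite leqNgt Xn.
Qed.

Section distance_to_integers.
Variable R : realType.
Implicit Types (t x y c : R).

(** Up to pi / 4 the mean value theorem applies with cos >= 1/2; beyond it, sin x >= 1/2 while x <
    2. *)
Lemma sin_ge_quarter x : 0 <= x <= pi / 2 -> x / 4 <= sin x.
Proof.
move=> /andP[x0 xpi].
have p0 := @pi_gt0 R; have p2 := @pihalf_lt2 R.
have q2 : 1 / 2 <= cos (pi / 4 : R).
  have q0 : 0 < cos (pi / 4 : R).
    by rewrite cos_gt0_pihalf//; apply/andP; split; lra.
  have := @cos_mulr2n R (pi / 4).
  have -> : pi / 4 *+ 2 = pi / 2 :> R by rewrite -mulr_natr; field.
  by rewrite cos_pihalf; nra.
have s2 : 1 / 2 <= sin (pi / 4 : R).
  by rewrite -cosBpihalf -cosN (_ : - (pi / 4 - pi / 2) = pi / 4)//; field.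
have [xq|qx] := lerP x (pi / 4); last first.
  apply: (@le_trans _ _ (sin (pi / 4))); first by lra.
  rewrite ltW// ltr_sin ?in_itv//=; apply/andP; split; lra.
have [->|xn0] := eqVneq x 0; first by rewrite mul0r sin0.
have xp : 0 < x by rewrite lt_neqAle eq_sym xn0.
have dsin (z : R) : z \in `]0, x[ -> is_derive z 1 sin (cos z).
  by move=> _; exact: is_derive_sin.
have csin : {within `[0, x], continuous (@sin R)}.
  by apply: continuous_subspaceT => z; exact: continuous_sin.
have [c] := MVT xp dsin csin; rewrite in_itv/= => /andP[c0 cx]; rewrite sin0 !subr0 => ->.
have : cos (pi / 4) <= cos c.
  by rewrite ltW// ltr_cos ?in_itv/=; [lra|apply/andP; split; lra..].
by nra.
Qed.

Lemma cosD2piz x (m : int) : cos (x + 2 * pi * m%:~R) = cos x.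
Proof.
case: m => n; first exact: cosD2pin.
rewrite -[LHS](cosD2pin _ _ n.+1); congr cos.
by rewrite NegzE mulrNz; ring.
Qed.

(** For y = t - m with [m] a nearest integer, 1 - cos (2 pi y) = 2 sin^2 (pi |y|) >= y^2 / 2. *)
Lemma cos_near_int t c : 0 <= c -> 1 - cos (2 * pi * t) < c ^+ 2 / 8 ->
  exists m : int, `|t - m%:~R| < c.
Proof.
move=> c0 h; pose m := Num.floor (t + 2^-1); exists m.
pose y := t - m%:~R; rewrite -/y.
have /andP[fl fu] := floor_itv (t + 2^-1); rewrite -/m in fl fu.
have yb : `|y| <= 2^-1.
  rewrite ler_norml /y; move: fu; rewrite intrD => fu.
  by apply/andP; split; lra.
have tE : 2 * pi * t = 2 * pi * y + 2 * pi * m%:~R by rewrite /y; ring.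
move: h; rewrite tE cosD2piz -cos_norm => h.
have p0 := @pi_gt0 R; have p2 := @pi_ge2 R.
pose z := pi * `|y|.
have zE : `|2 * pi * y| = z *+ 2.
  by rewrite !normrM (ger0_norm (ltW p0)) ger0_norm// -[RHS]mulr_natl /z mulrA.
have z0 : 0 <= z by apply: mulr_ge0 => //; exact: ltW.
have zpi : z <= pi / 2 by rewrite /z; nra.
move: h; rewrite zE cos_mulr2n cos2sin2 => h.
have sz : z / 4 <= sin z by apply: sin_ge_quarter; rewrite z0.
have yz : `|y| / 2 <= z / 4 by rewrite /z; have := normr_ge0 y; nra.
have : `|y| ^+ 2 < c ^+ 2 by have := normr_ge0 y; nra.
by rewrite ltr_sqr ?nnegrE.
Qed.

Lemma dist_int_ltP t c :
  dist_int t < c <-> exists m : int, `|t - m%:~R| < c.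
Proof.
split=> [h|[m mc]].
  have [|_ [m _ <-] mc] := inf_lt _ h; last by exists m.
  by exists `|t - 0%:~R|, 0.
apply: le_lt_trans mc; apply: ge_inf; last by exists m.
by exists 0 => _ [z _ <-].
Qed.

Lemma measurable_dist_int_lt (b c : R) :
  measurable [set x : R | dist_int (b * x) < c].
Proof.
rewrite (_ : [set _ | _] = \bigcup_(m : int) [set x : R | `|b * x - m%:~R| < c]).
  apply: countable_bigcupT_measurable => // m.
  have mf : measurable_fun setT (fun x : R => `|b * x - m%:~R|).
    apply: (measurableT_comp (@normr_measurable R setT)).
    by apply: measurable_funB => //; exact: mulrl_measurable.
  rewrite (_ : [set _ | _] = setT `&` (fun x : R => `|b * x - m%:~R|) @^-1` `]-oo, c[).
    by apply: mf => //; exact: measurable_itv.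
  by rewrite setTI; apply/seteqP; split=> x /=; rewrite in_itv.
apply/seteqP; split=> [x /dist_int_ltP[m xm]|x [m _ xm]]; first by exists m.
by apply/dist_int_ltP; exists m.
Qed.

End distance_to_integers.

(** * Measurability of the Cantor set *)

Section cantor_set_measurable.
Variable R : realType.
Implicit Types (a : nat -> R) (x : R).

Definition digits02 a := forall k, a k = 0 \/ a k = 2.

(** The tail is at most the geometric series with all digits equal to 2, whose sum is 3^(-n). *)
Lemma ternary_sum_bounds a x n : digits02 a -> ternary_sum a @ \oo --> x ->
  ternary_sum a n <= x <= ternary_sum a n + 3 ^- n.
Proof.
move=> a02 ax.
have inc m : ternary_sum a n <= ternary_sum a (n + m) <=
    ternary_sum a n + (3 ^- n - 3 ^- (n + m)).
  elim: m => [|m /andP[lo hi]]; first by rewrite addn0 subrr addr0 lexx.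
  rewrite addnS /ternary_sum seriesSr -/(ternary_sum a).
  have h : 3 ^- (n + m) = 3 * 3 ^- (n + m).+1 :> R.
    by rewrite exprS invfM mulrA mulfV ?mul1r.
  have p : 0 < 3 ^- (n + m).+1 :> R by rewrite invr_gt0 exprn_gt0.
  move: hi; rewrite h => hi.
  by case: (a02 (n + m)%N) => ->; apply/andP; split; lra.
apply/andP; split.
  rewrite -(cvg_lim (@Rhausdorff R) ax); apply: limr_ge; first by apply/cvg_ex; exists x.
  exists n => // m /= /subnKC <-; by have /andP[] := inc (m - n)%N.
rewrite -(cvg_lim (@Rhausdorff R) ax); apply: limr_le; first by apply/cvg_ex; exists x.
exists n => // m /= /subnKC <-; have /andP[_ h] := inc (m - n)%N.
by apply: le_trans h _; rewrite lerD2l gerBl invr_ge0 exprn_ge0.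
Qed.

(** On C this deletes the first ternary digit, the cut 1/2 lying in the middle gap. Points of that
    gap are sent outside [0, 1]. *)
Definition unfold3 x : R := if x < 2^-1 then 3 * x else 3 * x - 2.

Lemma cantor_set_unfold3 x : cantor_set x -> cantor_set (unfold3 x).
Proof.
move=> [_ [a a02 ax]].
have fx : unfold3 x = 3 * x - a 0%N.
  have := ternary_sum_bounds a x 1 a02 ax.
  rewrite /ternary_sum /series/= big_nat1 expr1 /unfold3.
  by case: (a02 0%N) => -> /andP[lo hi]; case: ltP => h; lra.
have b02 : digits02 (fun k => a k.+1) by move=> k; exact: a02.
have bx : ternary_sum (fun k => a k.+1) @ \oo --> unfold3 x.
  have E : ternary_sum (fun k => a k.+1) =
      (fun n => 3 * ternary_sum a n.+1 - a 0%N).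
    apply/funext => n; rewrite /ternary_sum /series /= big_nat_recl// expr1.
    rewrite mulrDr [3 * (_ / 3)]mulrC divfK// addrAC subrr add0r mulr_sumr.
    apply: eq_bigr => i _; rewrite [3 ^+ i.+2]exprS.
    by field; rewrite expf_neq0.
  rewrite E fx; apply: cvgB; last exact: cvg_cst.
  apply: cvgMr; rewrite -(cvg_shiftS (ternary_sum a)) in ax; exact: ax.
have b01 := ternary_sum_bounds _ _ 0 b02 bx.
split; last by exists (fun k => a k.+1).
by move: b01; rewrite /ternary_sum /series /= big_geq// add0r expr0 invr1.
Qed.

(** This replaces the quantifier over digit sequences by countably many measurable conditions.
    Conversely, digits are read off the orbit, and the remainder after [n] of them is the n-th
    iterate divided by 3^n. *)
Lemma cantor_setP x :
  cantor_set x <-> forall n, 0 <= iter n unfold3 x <= 1.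
Proof.
split=> [Cx n|h].
  suff : cantor_set (iter n unfold3 x) by case.
  by elim: n => //= n; exact: cantor_set_unfold3.
split; first exact: h 0%N.
pose a n : R := if iter n unfold3 x < 2^-1 then 0 else 2.
exists a; first by move=> k; rewrite /a; case: ifP; [left|right].
have aE n : ternary_sum a n = x - iter n unfold3 x * 3^-1 ^+ n.
  elim: n => [|n ih].
    by rewrite /ternary_sum /series /= big_geq// expr0 mulr1 subrr.
  rewrite /ternary_sum seriesSr -/(ternary_sum a) ih iterS /unfold3 /a.
  rewrite -exprVn !exprS.
  by case: ifP => _; field; rewrite ?expf_neq0.
have -> : ternary_sum a = (fun n => x - iter n unfold3 x * 3^-1 ^+ n).
  by apply/funext.
rewrite -[X in _ --> X]subr0; apply: cvgB; first exact: cvg_cst.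
apply: (@squeeze_cvgr _ _ _ _ (fun=> 0) (geometric 1 3^-1)).
- near=> n; have /andP[h0 h1] := h n.
  by rewrite /= mulr_ge0 ?exprn_ge0 ?invr_ge0//= ler_wpM2r ?exprn_ge0 ?invr_ge0.
- exact: cvg_cst.
- by apply: cvg_geometric; rewrite ger0_norm; lra.
Unshelve. all: by end_near. Qed.

Lemma measurable_cantor_set : measurable (@cantor_set R).
Proof.
have mu3 : measurable_fun setT unfold3.
  apply: measurable_fun_ifT; last 2 first.
  - exact: mulrl_measurable.
  - by apply: measurable_funB => //; exact: mulrl_measurable.
  - exact: measurable_fun_ltr.
have miter n : measurable_fun setT (iter n unfold3).
  elim: n => [|n ih]; first exact: measurable_id.
  exact: (measurableT_comp mu3 ih).
rewrite (_ : @cantor_set R =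
    \bigcap_n (setT `&` (fun x => iter n unfold3 x) @^-1` `[0, 1])).
  apply: bigcap_measurable => // n _.
  by apply: miter => //; exact: measurable_itv.
apply/seteqP; split=> [x /cantor_setP h n _|x h].
  by split=> //=; rewrite in_itv/=.
by apply/cantor_setP => n; have [_] := h n I; rewrite /= in_itv.
Qed.

End cantor_set_measurable.

(** * Random digits *)

Section random_digits.
Variables (R : realType) (d : measure_display) (T : measurableType d).
Variables (P : probability T R) (a : nat -> {RV P >-> R}) (X : {RV P >-> R}).
Hypothesis a_indep : mutually_independent a.
Hypothesis a_unif : forall k, uniform_on_0_2 (a k).
Hypothesis a_cvg : {ae P, forall w, ternary_sum (fun k => a k w) @ \oo --> X w}.

Definition cylinder (w : seq bool) : set T :=
  \bigcap_(k in `I_(size w)) (a k @^-1` [set digit02 R (nth false w k)]).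

Lemma measurable_preimage_RV (Y : {RV P >-> R}) (B : set R) :
  measurable B -> measurable (Y @^-1` B).
Proof. by move=> mB; rewrite -[_ @^-1` _]setTI; exact: measurable_funP. Qed.

Lemma measurable_cylinder w : measurable (cylinder w).
Proof.
by apply: bigcap_measurableType => k _; exact: measurable_preimage_RV.
Qed.

Lemma probability_cylinder w : P (cylinder w) = (2^-1 ^+ size w)%:E.
Proof.
pose J := [fset k in iota 0 (size w)]%fset.
have -> : cylinder w =
    \bigcap_(k in [set` J]) (a k @^-1` [set digit02 R (nth false w k)]).
  congr (bigcap _ _); apply/seteqP; split=> k;
  by rewrite /= !inE /= mem_iota add0n.
rewrite (a_indep J (fun k => [set digit02 R (nth false w k)]))//.
rewrite (eq_bigr (fun=> (2^-1)%:E)); last first.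
  move=> k _; have [a0 a2] := a_unif k.
  by rewrite /digit02; case: ifP.
rewrite prodEFin; congr EFin.
rewrite (perm_big (iota 0 (size w))); last first.
  apply: uniq_perm; rewrite ?fset_uniq ?iota_uniq// => k.
  by rewrite !inE.
by rewrite -{1}[size w]subn0 (big_mkord xpredT (fun=> 2^-1)) prodr_const card_ord.
Qed.

Lemma ae_digits : {ae P, forall t, digits02 R (fun k => a k t)}.
Proof.
apply: ae_foralln => k; have [a0 a2] := a_unif k.
pose A := a k @^-1` [set (0 : R)] `|` a k @^-1` [set (2 : R)].
have m0 : measurable (a k @^-1` [set (0 : R)]) by exact: measurable_preimage_RV.
have m2 : measurable (a k @^-1` [set (2 : R)]) by exact: measurable_preimage_RV.
have mA : measurable A by exact: measurableU.
have PA : P A = 1%E.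
  have -> : P A = (P (a k @^-1` [set 0%R]) + P (a k @^-1` [set 2%R]))%E.
    apply: measureU => //; rewrite -subset0 => t [/= -> /eqP].
    by rewrite eq_sym pnatr_eq0.
  by rewrite a0 a2 -EFinD; congr EFin; lra.
exists (~` A); split; first exact: measurableC.
- have PAc : P (~` A) = (1 - P A)%E by exact: probability_setC.
  by apply: (etrans PAc); rewrite PA subee.
- by move=> t nt [h|h]; apply: nt; [left|right].
Qed.

(** Any value other than 2 is read as [false], which is faithful almost surely. *)
Definition first_digits (L : nat) (t : T) : seq bool :=
  [seq a k t == 2 | k <- iota 0 L].

Lemma size_first_digits L t : size (first_digits L t) = L.
Proof. by rewrite size_map size_iota. Qed.

Lemma nth_first_digits L t k : (k < L)%N ->
  nth false (first_digits L t) k = (a k t == 2).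
Proof. by move=> kL; rewrite (nth_map 0%N) ?size_iota// nth_iota. Qed.

Lemma digit02_first_digits L t k : digits02 R (fun k => a k t) -> (k < L)%N ->
  digit02 R (nth false (first_digits L t) k) = a k t.
Proof.
move=> a02 kL; rewrite nth_first_digits// /digit02.
by case: (a02 k) => -> //; rewrite ?eqxx// eq_sym pnatr_eq0.
Qed.

Lemma pt_first_digits L t : digits02 R (fun k => a k t) ->
  pt (first_digits L t) = ternary_sum (fun k => a k t) L.
Proof.
move=> a02; rewrite /pt size_first_digits /ternary_sum /series /= big_mkord.
by apply: eq_bigr => k _; rewrite digit02_first_digits.
Qed.

Lemma mem_words w : w \in words (size w).
Proof.
elim/last_ind: w => // w b ih; rewrite size_rcons wordsS.
by apply/allpairsP; exists (w, b); split => //; case: b.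
Qed.

(** Off a null set, [E] is covered by the cylinders of the bad words, each of probability 2^(-L);
    the union bound concludes. *)
Lemma probability_le_count L (bad : pred (seq bool)) (E : set T) :
  measurable E ->
  (forall t, digits02 R (fun k => a k t) ->
     ternary_sum (fun k => a k t) @ \oo --> X t -> E t ->
     bad (first_digits L t)) ->
  (P E <= (\sum_(w <- words L) (bad w)%:R * 2^-1 ^+ L)%:E)%E.
Proof.
move=> mE Ebad.
have cyl_le (s : seq (seq bool)) : {in s, forall w, size w = L} ->
    measurable (\big[setU/set0]_(w <- s | bad w) cylinder w) /\
    (P (\big[setU/set0]_(w <- s | bad w) cylinder w) <=
      (\sum_(w <- s) (bad w)%:R * 2^-1 ^+ L)%:E)%E.
  elim: s => [_|w s ih ws]; first by rewrite !big_nil measure0.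
  have [|ms Ps] := ih; first by move=> v vs; apply: ws; rewrite inE vs orbT.
  rewrite !big_cons; case: ifP => _; last by rewrite mul0r add0r.
  have mw := measurable_cylinder w.
  split; first exact: measurableU.
  apply: le_trans (measureU2 _ mw ms) _.
  rewrite EFinD leeD// mul1r -(ws w) ?inE ?eqxx//.
  by rewrite le_eqVlt; apply/orP; left; apply/eqP; exact: probability_cylinder.
have [mU PU] := cyl_le (words L) (fun w => @size_words L w).
have /= [Z [mZ PZ ZP]] : {ae P, forall t, digits02 R (fun k => a k t) /\
    ternary_sum (fun k => a k t) @ \oo --> X t}.
  by apply: filterS2 ae_digits a_cvg => t h1 h2; split.
apply: le_trans PU.
rewrite -[leRHS]add0e -PZ; apply: le_trans (measureU2 _ mZ mU).
have mZU := measurableU _ _ mZ mU.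
apply: le_measure; [exact: mem_set|exact: mem_set|].
move=> t Et; have [Zt|nZt] := pselect (Z t); [by left|right].
have [t02 tX] : digits02 R (fun k => a k t) /\
    ternary_sum (fun k => a k t) @ \oo --> X t.
  by apply: contrapT => nh; apply: nZt; apply: ZP.
have fw : first_digits L t \in words L.
  by rewrite -{2}(size_first_digits L t); exact: mem_words.
have fb := Ebad t t02 tX Et.
rewrite -bigcup_seq_cond; exists (first_digits L t) => /=.
  by rewrite fw fb.
by rewrite /cylinder size_first_digits => k /= kL; rewrite digit02_first_digits.
Qed.

End random_digits.

(** * Probability of a block without a close approach *)

Section hitting.
Variables (R : realType) (d : measure_display) (T : measurableType d).
Variables (P : probability T R) (a : nat -> {RV P >-> R}) (X : {RV P >-> R}).
Hypothesis a_indep : mutually_independent a.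
Hypothesis a_unif : forall k, uniform_on_0_2 (a k).
Hypothesis a_cvg : {ae P, forall w, ternary_sum (fun k => a k w) @ \oo --> X w}.

(** The stage [L] is so deep that 2^(M+n) X and its truncation differ by at most 1 / K. A hit within
    7 / K for the truncation is thus one within 8 / K for X, so a block without hits forces a bad
    word. *)
Lemma probability_no_hit M k K (N := (2 * 3 ^ k)%N) : (0 < K)%N ->
  (P (X @^-1` (~` \bigcup_(i in `I_N)
       [set x : R | (dist_int (2 ^+ (M + i) * x) < 8 / K%:R)%R]))
   <= (30 * K%:R * Num.sqrt (2 / 3) ^+ k)%:E)%E.
Proof.
move=> K0; pose r : R := Num.sqrt (2 / 3).
have r0 : 0 < r by rewrite sqrtr_gt0; lra.
have r2 : r ^+ 2 = 2 / 3 by rewrite sqr_sqrtr//; lra.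
have K0r : 0 < K%:R :> R by rewrite ltr0n.
have N0 : 0 < N%:R :> R by rewrite ltr0n muln_gt0 expn_gt0.
set L := (k.+1 + (2 * K).+1 * 2 ^ (M + N))%N.
(* As N = 2 * 3^k and r^2 = 2/3, this is exactly the root of 4 N 2^(k+1), and 15 K sg / N = 30 K
   r^k. *)
pose sg : R := N%:R * (2 * r ^+ k).
have sg0 : 0 < sg by rewrite mulr_gt0// mulr_gt0// exprn_gt0.
have sg2 : 4 * N%:R * 2 ^+ k.+1 <= sg ^+ 2.
  rewrite le_eqVlt; apply/orP; left; apply/eqP.
  have -> : sg ^+ 2 = N%:R * N%:R * 4 * (r ^+ 2) ^+ k.
    by rewrite -exprM mulnC exprM /sg; ring.
  rewrite r2 expr_div_n {3}/N natrM natrX exprS.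
  by field; rewrite expf_neq0.
have KL : (K * 2 ^ (M + N) <= 3 ^ L)%N.
  apply: leq_trans (ltnW (ltn_expl L (isT : 1 < 3)%N)).
  by apply: leq_trans (leq_addl _ _); rewrite leq_mul2r; apply/orP; right; lia.
have := count_no_hit R k L M K sg K0 (leqnn _) sg0 sg2; rewrite -/N.
set bad := fun w => [forall n : 'I_N,
  6 / K%:R ^+ 2 <= 1 - cos (dyadic_angle R M w n)] => count.
apply: (@le_trans _ _ (\sum_(w <- words L) (bad w)%:R * 2^-1 ^+ L)%:E); last first.
  rewrite lee_fin -mulr_suml.
  rewrite -mulr_suml -/(bad _) in count.
  rewrite exprVn ler_pdivrMr ?exprn_gt0// -(ler_pM2r N0).
  by apply: le_trans count _; rewrite /sg le_eqVlt; apply/orP; left; apply/eqP; ring.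
apply: (probability_le_count R d T P a X a_indep a_unif a_cvg L bad).
  apply: measurable_preimage_RV; apply: measurableC.
  by apply: bigcup_measurable => n _; exact: measurable_dist_int_lt.
move=> t t02 tX Et; apply/forallP => n; rewrite leNgt; apply/negP => h.
apply: Et; exists n => //=.
apply/dist_int_ltP.
pose y : R := pt (first_digits R d T P a L t).
(* The 7 works because 7^2 / 8 > 6. *)
have [||m mh] := @cos_near_int R (2 ^+ (M + n) * y) (7 / K%:R).
- by rewrite divr_ge0.
- rewrite [2 * pi * _]mulrA; apply: lt_le_trans h _.
  by rewrite expr_div_n -mulrA [_ / 8]mulrC mulrA ler_wpM2r ?invr_ge0 ?exprn_ge0//; lra.
exists m.
have /andP[lo hi] := ternary_sum_bounds R _ _ L t02 tX.
rewrite -(pt_first_digits R d T P a L t t02) -/y in lo hi.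
have tail : `|2 ^+ (M + n) * X t - 2 ^+ (M + n) * y| <= K%:R^-1.
  rewrite -mulrBr ger0_norm; last by rewrite mulr_ge0 ?exprn_ge0// subr_ge0.
  apply: (@le_trans _ _ (2 ^+ (M + N) * 3 ^- L)).
    apply: ler_pM; rewrite ?exprn_ge0 ?subr_ge0//; last by lra.
    by rewrite ler_eXn2l ?ltr1n// leq_add2l ltnW.
  rewrite ler_pdivrMr ?exprn_gt0// ler_pdivlMl//.
  by rewrite -!natrX -natrM ler_nat.
have -> : 2 ^+ (M + n) * X t - m%:~R =
    (2 ^+ (M + n) * X t - 2 ^+ (M + n) * y) + (2 ^+ (M + n) * y - m%:~R) by ring.
apply: le_lt_trans (ler_normD _ _) _.
have -> : 8 / K%:R = K%:R^-1 + 7 / K%:R :> R by field; rewrite gt_eqF.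
exact: ler_ltD.
Qed.

(** The event lies in the event of no hit in the block of 2 * 3^k exponents after [M], for every
    large [k]. With K of order b^k, where b = 3^tau, its probability is O((b r)^k), which tends to
    0. *)
Lemma negligible_no_hit tau M :
  0 < tau -> tau < (1 - ln 2 / ln 3) / 2 ->
  P.-negligible (X @^-1` (~` \bigcup_(n in [set n | (M < n)%N])
      [set x : R | dist_int (2 ^+ n * x) < n%:R `^ (- tau)])).
Proof.
move=> tau0 taul; set E := X @^-1` _.
have mE : measurable E.
  apply: measurable_preimage_RV; apply: measurableC.
  by apply: bigcup_measurable => n _; exact: measurable_dist_int_lt.
suff PE0 : P E = 0%E by exists E; split.
pose b : R := 3 `^ tau; pose r : R := Num.sqrt (2 / 3).
have b1 : 1 <= b.
  have : (3 : R) `^ 0 <= 3 `^ tau by rewrite ler_powR ?ltW// ltr1n.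
  by rewrite powRr0.
have r0 : 0 < r by rewrite sqrtr_gt0; lra.
(* The bound on [tau] enters here: after taking logarithms of squares, the claim is 2 tau ln 3 + ln
   2 - ln 3 < 0. *)
have br : b * r < 1.
  have ln3 : 0 < ln 3 :> R by rewrite ln_gt0// ltr1n.
  have : b ^+ 2 * (2 / 3) < 1.
    have -> : b ^+ 2 = expR (2 * tau * ln 3).
      by rewrite /b /powR gt_eqF// -expRM_natl -mulr_natl mulrA.
    have -> : 2 / 3 = expR (ln 2 - ln 3) :> R by rewrite expRB !lnK ?posrE.
    rewrite -expRD -[ltRHS]expR0 ltr_expR.
    have : ln 2 = ln 2 / ln 3 * ln 3 :> R by rewrite divfK// gt_eqF.
    by move: (ln 2 / ln 3) taul => g taul ->; nra.
  have <- : r ^+ 2 = 2 / 3 by rewrite sqr_sqrtr//; lra.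
  rewrite -exprMn; have : 0 <= b * r by rewrite mulr_ge0// ltW//; lra.
  by move: (b * r) => x x0 x1; nra.
have Ek k : (M <= 3 ^ k)%N -> (P E <= (270 * b * (b * r) ^+ k)%:E)%E.
  (* This makes 8 / K < b^(-(k+1)) = (3^(k+1))^(-tau), the smallest radius needed since all
     exponents of the block are at most 3^(k+1). Also K <= 9 b^(k+1), whence 270 = 30 * 9. *)
  move=> Mk; pose K := (Num.truncn (8 * b ^+ k.+1)).+1.
  have bk1 : 1 <= b ^+ k.+1 by rewrite exprn_ege1.
  have /andP[Kl Kh] : K.-1%:R <= 8 * b ^+ k.+1 < K%:R.
    by apply: truncn_itv; lra.
  have K9 : K%:R <= 9 * b ^+ k.+1.
    by move: Kl; rewrite /K /= -[(_).+1%:R]natr1; lra.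
  apply: le_trans (_ : (_ <= (30 * K%:R * r ^+ k)%:E)%E) _; last first.
    rewrite lee_fin [leRHS](_ : _ = 30 * (9 * b ^+ k.+1) * r ^+ k).
      by rewrite ler_wpM2r ?exprn_ge0 ?(ltW r0)// ler_wpM2l.
    by rewrite exprMn exprS; ring.
  apply: le_trans (probability_no_hit M.+1 k K isT).
  apply: le_measure; [exact: mem_set|apply: mem_set|].
    apply: measurable_preimage_RV; apply: measurableC.
    by apply: bigcup_measurable => n _; exact: measurable_dist_int_lt.
  apply: preimage_subset; apply: subsetC => x [i /= iN xi].
  exists (M.+1 + i)%N; first by rewrite /= addSn ltnS leq_addr.
  rewrite /=; apply: lt_le_trans xi _.
  have n3 : (M.+1 + i <= 3 ^ k.+1)%N by rewrite expnS; lia.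
  apply: (@le_trans _ _ ((3 ^ k.+1)%:R `^ (- tau))); last first.
    rewrite !powRN lef_pV2 ?posrE ?powR_gt0 ?ltr0n ?expn_gt0//.
    by apply: ge0_ler_powR; rewrite ?nnegrE ?(ltW tau0)// ler_nat.
  have -> : (3 ^ k.+1)%:R `^ (- tau) = (b ^+ k.+1)^-1.
    rewrite powRN natrX /b -!powR_mulrn ?powR_ge0// -!powRrM mulrC//.
  rewrite ler_pdivrMr ?ltr0n// mulrC ler_pdivlMr; last by lra.
  by rewrite ltW.
apply/eqP; rewrite eq_le; apply/andP; split; last exact: measure_ge0.
have cv : (270 * b * (b * r) ^+ k)%:E @[k --> \oo] --> 0%E.
  apply: cvg_EFin; first by near=> k.
  apply: cvg_geometric; rewrite ger0_norm//.
  by rewrite mulr_ge0// ltW//; lra.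
apply: cvge_ge cv; exists M => // k /= Mk; apply: Ek.
by apply: leq_trans Mk (ltnW (ltn_expl _ _)).
Unshelve. all: by end_near. Qed.

End hitting.

(** * Infinitely many approaches almost surely *)

Theorem theorem2 (R : realType) (mu : probability R R)
    (tau : R) :
  is_cantor_measure mu ->
  0 < tau -> tau < (1 - ln 2 / ln 3) / 2 ->
  mu [set x : R | cantor_set x /\
        infinite_set [set n : nat | (0 < n)%N /\
          dist_int (2 ^+ n * x) < n%:R `^ (- tau)]] = 1%E.
Proof.
move=> [d [T [P [a [X [a_indep a_unif a_cvg muE]]]]]] tau0 taul.
pose H M := \bigcup_(n in [set n | (M < n)%N])
  [set x : R | dist_int (2 ^+ n * x) < n%:R `^ (- tau)].
(* Infinitely many hits means a hit beyond every [M]; the strict bound M < n also supplies n > 0. *)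
have -> : [set x : R | cantor_set x /\ infinite_set [set n : nat | (0 < n)%N /\
    dist_int (2 ^+ n * x) < n%:R `^ (- tau)]] =
    @cantor_set R `&` \bigcap_M H M.
  apply/seteqP; split=> x [Cx] => [/infinite_nat_setP h|h]; split => //.
    by move=> M _; have [n Mn [_ xn]] := h M.+1; exists n.
  apply/infinite_nat_setP => M; have [n Mn xn] := h M I.
  exists n; first exact: ltnW.
  by split => //; exact: leq_ltn_trans Mn.
have mS : measurable (@cantor_set R `&` \bigcap_M H M).
  apply: measurableI; first exact: measurable_cantor_set.
  apply: bigcapT_measurable => M; apply: bigcup_measurable => n _.
  exact: measurable_dist_int_lt.
set S := _ `&` _ in mS *.
rewrite muE//.
have mXS : measurable (X @^-1` S) by exact: measurable_preimage_RV.
(* The complement is covered by the null event that X is outside C and countably many null events of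
   no hit beyond [M]. *)
have [Z [mZ PZ SZ]] : P.-negligible (~` (X @^-1` S)).
  have nH : P.-negligible (\bigcup_M (X @^-1` (~` H M))).
    by apply: negligible_bigcup => M; exact: (negligible_no_hit R d T P a X a_indep a_unif a_cvg).
  have nC : {ae P, forall t, cantor_set (X t)}.
    apply: filterS2 (ae_digits R d T P a a_unif) a_cvg => t t02 tX.
    split; last by exists (fun k => a k t).
    have := ternary_sum_bounds R _ _ 0 t02 tX.
    by rewrite /ternary_sum /series /= big_geq// add0r expr0 invr1.
  apply: negligibleS (negligibleU nC nH) => t /=.
  move=> nS; have [Ct|nCt] := pselect (cantor_set (X t)); [right|by left].
  apply: contrapT => nh; apply: nS; split => // M _.
  by apply: contrapT => nhM; apply: nh; exists M.
have PS0 : P (~` (X @^-1` S)) = 0%E.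
  apply: (subset_measure0 _ mZ SZ PZ); exact: measurableC.
have PS1 : P (~` (X @^-1` S)) = (1 - P (X @^-1` S))%E by exact: probability_setC.
have fP : P (X @^-1` S) \is a fin_num by exact: fin_num_measure.
rewrite /distribution /pushforward/=.
by move: PS1; rewrite PS0 -(fineK fP) -EFinB => -[h]; congr EFin; lra.
Qed.
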